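(* Let $p>2$ be a prime and let $G_1=G(p;A_1),\dots,G_n=G(p;A_n)$ be connected circulants on $p$ vertices (either all digraphs, or all graphs with $A_i=-A_i$). Let $\mathbf{M}=\mathrm{diag}(p,p,\dots,p)\in\mathbb{Z}^{n\times n}$ and $A=\{a\mathbf{e}_i : a\in A_i,\ 1\le i\le n\}$, where $\mathbf{e}_i$ is the $i$th unit vector. Then the multidimensional circulant $G(\mathbf{M};A)$ (which is the cartesian product $G_1\times\cdots\times G_n$) has dimension $n$.
   Context: For $A_i\subseteq\mathbb{Z}/p\mathbb{Z}\setminus\{0\}$, the circulant $G(p;A_i)$ has vertex set $\mathbb{Z}/p\mathbb{Z}$ with $u$ adjacent to $u+a \bmod p$ for $a\in A_i$ (a graph when $A_i=-A_i$). For a nonsingular $\mathbf{M}\in\mathbb{Z}^{n\times n}$ and $A\subseteq\mathbb{Z}^n/\mathbf{M}\mathbb{Z}^n$, the multidimensional circulant $G(\mathbf{M};A)$ has vertex set $\mathbb{Z}^n/\mathbf{M}\mathbb{Z}^n$ (integer vectors modulo the lattice spanned by the columns of $\mathbf{M}$) with arcs $\mathbf{u}\to\mathbf{u}+\mathbf{a}\pmod{\mathbf{M}}$, $\mathbf{a}\in A$ (a graph when $A=-A$). The dimension of a (di)graph is the smallest $n'$ such that it is isomorphic to a multidimensional circulant $G(\mathbf{M}';A')$ with $\mathbf{M}'$ a nonsingular $n'\times n'$ integer matrix; equivalently the minimum rank of an abelian group of which it is a Cayley (di)graph. *)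

(* Defs.v *)
From HB Require Import structures.
From mathcomp Require Import all_boot all_order all_algebra.
From mathcomp Require Import boolp classical_sets.

Set Implicit Arguments.
Unset Strict Implicit.
Unset Printing Implicit Defensive.
Import GRing.Theory.
Local Open Scope ring_scope.

Definition lattice n (M : 'M[int]_n) : {pred 'cV[int]_n} :=
  fun u => `[< exists z : 'cV[int]_n, u = M *m z >].

Fact lattice_zmod_closed n (M : 'M[int]_n) : zmod_closed (lattice M).
Proof.
split; first by apply/asboolP; exists 0; rewrite mulmx0.
move=> u v /asboolP[y ->] /asboolP[z ->].
by apply/asboolP; exists (y - z); rewrite mulmxBr.
Qed.

HB.instance Definition _ n (M : 'M[int]_n) :=
  GRing.isZmodClosed.Build 'cV[int]_n (lattice M) (lattice_zmod_closed M).

(* The abelian group Z^n / M Z^n; finite exactly when M is nonsingular. *)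
Definition int_mod n (M : 'M[int]_n) : zmodType :=
  @Quotient.quot 'cV[int]_n (lattice M).

Definition to_mod n (M : 'M[int]_n) (u : 'cV[int]_n) : int_mod M :=
  (\pi_(@Quotient.quot 'cV[int]_n (lattice M)) u)%qT.

Fact to_mod_eq n (M : 'M[int]_n) (u v : 'cV[int]_n) :
  to_mod M u = to_mod M v <-> exists z : 'cV[int]_n, u - v = M *m z.
Proof.
split=> [/eqP | uv]; last apply/eqP; rewrite -Quotient.idealrBE.
  by move/asboolP.
exact/asboolP.
Qed.

(* A digraph on T is its arc relation T -> T -> Prop; a graph is a digraph
   whose arc relation is symmetric (every edge is a pair of opposite arcs). *)
Definition digraph_iso (T1 T2 : Type) (E1 : T1 -> T1 -> Prop)
    (E2 : T2 -> T2 -> Prop) : Prop :=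
  exists2 f : T1 -> T2, bijective f & forall u v, E1 u v <-> E2 (f u) (f v).

Definition mcirculant n (M : 'M[int]_n) (A : set (int_mod M))
    (u v : int_mod M) : Prop :=
  exists2 a, A a & v = u + a.

Definition is_mcirculant (T : Type) (E : T -> T -> Prop) (n : nat) : Prop :=
  exists (M : 'M[int]_n) (A : set (int_mod M)),
    \det M != 0 /\ digraph_iso E (mcirculant A).

Definition has_dimension (T : Type) (E : T -> T -> Prop) (n : nat) : Prop :=
  is_mcirculant E n /\ forall m : nat, is_mcirculant E m -> (n <= m)%N.

(* For a graph E, requiring the connection sets A' in the definition of the
   dimension to satisfy A' = - A' changes nothing: it is automatic. *)
Fact mcirculant_sym (T : Type) (E : T -> T -> Prop) n (M : 'M[int]_n)
    (A : set (int_mod M)) :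
  (forall u v, E u v -> E v u) -> digraph_iso E (mcirculant A) ->
  forall a, A a -> A (- a).
Proof.
move=> symE [f [g fK gK] fE] a Aa.
have /symE : E (g 0) (g a) by apply/fE; rewrite !gK; exists a; rewrite ?add0r.
move/fE; rewrite !gK => -[b Ab /eqP].
by rewrite eq_sym addrC addr_eq0 => /eqP <-.
Qed.

(* Used only for p > 1, where 'Z_p is Z/pZ. *)
Definition circulant (p : nat) (A : {set 'Z_p}) : rel 'Z_p :=
  fun u v => [exists a in A, v == u + a].

(* For digraphs, connectedness of the underlying graph. *)
Definition connected (T : finType) (e : rel T) : Prop :=
  forall u v : T, connect [rel x y | e x y || e y x] u v.

Definition cartesian_product n (T : Type) (E : 'I_n -> T -> T -> Prop)
    (u v : {ffun 'I_n -> T}) : Prop :=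
  exists i : 'I_n, E i (u i) (v i) /\ forall j : 'I_n, j != i -> u j = v j.

Definition axis_set (p n : nat) (A : 'I_n -> {set 'Z_p}) (M : 'M[int]_n) :
    set (int_mod M) :=
  [set x | exists (i : 'I_n) (a : 'Z_p),
     a \in A i /\ x = to_mod M ((nat_of_ord a)%:Z *: delta_mx i 0)]%classic.

Arguments axis_set {p n} A M _.

(* Main.v *)
(** Let f identify the product with a Cayley digraph of an abelian group H of
    order p ^ n.  Two neighbors of a vertex in different directions span a
    unique square; since H is abelian of odd order, this forces the arcs s and
    - s to leave every vertex in the same direction.  Hence h, h + s, h + 2s, ...
    stay on one line of p vertices, so the order of s is at most p, and being a
    power of p it divides p.  By connectedness H has exponent p, so m generators
    give at most p ^ m elements, and p ^ n <= p ^ m. *)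
Require Import Defs.
From mathcomp Require Import all_boot all_order all_algebra.
From mathcomp Require Import boolp classical_sets.
Local Open Scope ring_scope.

Set Implicit Arguments.
Unset Strict Implicit.
Unset Printing Implicit Defensive.
Import GRing.Theory.

(** * Element orders in abelian groups, and invariants of connected digraphs *)

Lemma mulrn_gcdn (H : zmodType) (h : H) a b :
  h *+ a = 0 -> h *+ b = 0 -> h *+ gcdn a b = 0.
Proof.
case: a => [|a] ha hb; first by rewrite gcd0n.
have [u v uv _] := egcdnP b (ltn0Sn a).
have : h *+ (u * a.+1) = 0 by rewrite mulnC mulrnA ha mul0rn.
by rewrite uv mulrnDr mulnC mulrnA hb mul0rn add0r.
Qed.

(** The gcd of [k] and [p ^ e] kills [h]; it is a power of [p] not exceeding [k <= p], hence a
    divisor of [p]. *)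
Lemma mulrn_prime_of_le (H : zmodType) (h : H) p e k : prime p ->
  h *+ (p ^ e) = 0 -> (0 < k <= p)%N -> h *+ k = 0 -> h *+ p = 0.
Proof.
move=> p_pr he /andP[k0 kp] hk.
have hg := mulrn_gcdn hk he.
have /(dvdn_pfactor _ _ p_pr)[j _ gE] := dvdn_gcdr k (p ^ e).
suff /dvdnP[c ->] : (gcdn k (p ^ e) %| p)%N by rewrite mulnC mulrnA hg mul0rn.
have : (p ^ j <= p ^ 1)%N.
  by rewrite -gE expn1 (leq_trans (dvdn_leq k0 (dvdn_gcdl _ _))).
by rewrite leq_exp2l ?prime_gt1// gE -{2}(expn1 p); apply: dvdn_exp2l.
Qed.

(* Lagrange: translation by h permutes the sum of all elements. *)
Lemma mulrn_card (T : finType) (H : zmodType) (f : T -> H) (h : H) :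
  bijective f -> h *+ #|T| = 0.
Proof.
move=> [g fK gK].
have /eqP : \sum_x f x = \sum_x (f x + h).
  rewrite (reindex (fun x => g (f x + h))) /=.
    by apply: eq_bigr => x _; rewrite gK.
  exists (fun x => g (f x - h)) => x _; first by rewrite gK addrK fK.
  by rewrite gK subrK fK.
rewrite big_split /= sumr_const -subr_eq0 opprD addrA subrr sub0r oppr_eq0.
by move/eqP.
Qed.

Lemma connected_const (T : finType) (H : Type) (e : rel T) (F : T -> H) :
  connected e -> (forall x y, e x y -> F x = F y) -> forall x y, F x = F y.
Proof.
move=> e_conn Fe x y; have /connectP[q] := e_conn x y.
elim: q x => [|z q IHq] x /=; first by move=> _ ->.
move=> /andP[xz zq] yq; rewrite -(IHq z zq yq).
by case/orP: xz => /Fe.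
Qed.

Definition on_line n (T : Type) (i : 'I_n) (u v : {ffun 'I_n -> T}) : Prop :=
  forall j, j != i -> u j = v j.

(** * Abelian Cayley structures on a cartesian product *)

Section ProductCayley.

Variables (n p : nat) (T : finType) (E : 'I_n -> rel T).
Hypotheses (p_prime : prime p) (p_odd : odd p) (cardT : #|T| = p).
Hypotheses (E_irr : forall i x, ~~ E i x x)
  (E_conn : forall i, connected (E i)).

Local Notation V := {ffun 'I_n -> T}.

(** Orientation is dropped: on the group side this is the Cayley graph of [A] together with [- A],
    so digraphs and graphs are treated alike. *)
Let adj (u v : V) : Prop :=
  exists2 i, on_line i u v & E i (u i) (v i) || E i (v i) (u i).

Variables (H : zmodType) (A : set H) (f : V -> H) (g : H -> V).
Hypotheses (fK : cancel f g) (gK : cancel g f).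
Hypothesis fE : forall u v,
  cartesian_product (fun i => E i) u v <-> exists2 a, A a & f v = f u + a.

Let adjP u v : adj u v <-> A (f v - f u) \/ A (f u - f v).
Proof.
have arc u' v' : A (f v' - f u') <-> cartesian_product (fun i => E i) u' v'.
  split=> [a | /fE[a Aa ->]]; last by rewrite addrC addKr.
  by apply/fE; exists (f v' - f u'); rewrite // addrC subrK.
rewrite !arc; split=> [[i uv /orP[] e] | [] [i [e uv]]].
- by left; exists i.
- by right; exists i; split=> // j /uv.
- by exists i; rewrite ?e.
- by exists i; rewrite ?e ?orbT // => j /uv.
Qed.

Let adj_sym u v : adj u v -> adj v u.
Proof. by move/adjP => uv; apply/adjP; case: uv; [right | left]. Qed.

Let adj_shift h k s : adj (g h) (g k) -> adj (g (h + s)) (g (k + s)).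
Proof.
move/adjP; rewrite !gK => hk; apply/adjP.
by rewrite !gK !opprD !(addrACA _ s) !subrr !addr0.
Qed.

Let adj_neq i u v : on_line i u v -> adj u v -> u i <> v i.
Proof.
move=> uv [j _ e] uvi; suff uvj : u j = v j.
  by move: e; rewrite uvj orbb (negPf (E_irr _ _)).
by have [->|/uv] := eqVneq j i.
Qed.

(** As [u] and [w] differ exactly at [i] and [j], a path of length two changes each of these
    coordinates once; the order of the changes determines its midpoint. *)
Let common_neighbor i j (u w v1 v2 z : V) : i != j ->
  u i <> v1 i -> u j <> v2 j ->
  on_line i u v1 -> on_line j v1 w -> on_line j u v2 -> on_line i v2 w ->
  adj u z -> adj z w -> z = v1 \/ z = v2.
Proof.
move=> ij ui uj uv1 v1w uv2 v2w [k uz _] [l zw _].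
have ji : j != i by rewrite eq_sym.
have wi : w i = v1 i by rewrite v1w.
have wj : w j = v2 j by rewrite v2w.
have [ki|ki] := eqVneq k i.
  subst k; left; have lj : l = j.
    by apply/eqP/contraT; rewrite eq_sym => /zw; rewrite -uz // wj.
  subst l; apply/ffunP => x; have [->|xi] := eqVneq x i; last by rewrite -uz ?uv1.
  by rewrite zw.
have li : l = i.
  by apply/eqP/contraT; rewrite eq_sym => /zw; rewrite -uz 1?eq_sym // wi.
subst l; right; have kj : k = j.
  by apply/eqP/contraT; rewrite eq_sym => /uz; rewrite zw // wj.
subst k; apply/ffunP => x; have [->|xj] := eqVneq x j; first by rewrite zw.
by rewrite -uz ?uv2.
Qed.

Let mulrn_card_H (h : H) : h *+ (p ^ n) = 0.
Proof.
rewrite -cardT -[X in (_ ^ X)%N]card_ord -card_ffun.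
by apply: (mulrn_card h (f := f)); exists g.
Qed.

(* If s and - s pointed in different directions i, j at h, the fourth vertex w
   of the square they span would be adjacent to h + s and h - s; then f w - s
   and f w + s are neighbors of h too, which forces f w = h + 2s = h - 2s. *)
Let on_line_opp i h s : adj (g h) (g (h + s)) ->
  on_line i (g h) (g (h + s)) -> on_line i (g h) (g (h - s)).
Proof.
move=> hs line_s.
have hNs : adj (g h) (g (h - s)).
  by apply: adj_sym; have := adj_shift (- s) hs; rewrite addrK.
have [j line_Ns e] := hNs.
have [<-//|ji] := eqVneq j i.
have ij : i != j by rewrite eq_sym.
have ns := adj_neq line_s hs; have nNs := adj_neq line_Ns hNs.
pose w : V := [ffun k => if k == j then g (h - s) j else g (h + s) k].
have l1 : on_line j (g (h + s)) w by move=> k kj; rewrite ffunE (negPf kj).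
have l2 : on_line i (g (h - s)) w.
  move=> k ki; rewrite ffunE; case: eqVneq => [->//|kj].
  by rewrite -line_Ns // -line_s.
have a1 : adj (g (h + s)) w.
  by exists j; rewrite // ffunE eqxx -line_s.
have a2 : adj (g (h - s)) w.
  have [i' line_i' e'] := hs.
  have ii' : i' = i.
    by apply/eqP/contraT; rewrite eq_sym => /line_i'.
  subst i'; exists i => //.
  by rewrite ffunE (negPf ij) -line_Ns.
have wh : f w <> h.
  by move=> wh; apply: ns; rewrite -{1}wh fK ffunE (negPf ij).
have w1 : f w = h + s + s.
  have b1 : adj (g h) (g (f w - s)).
    have := @adj_shift _ (f w) (- s) (eq_ind_r (adj _) a1 (fK w)).
    by rewrite addrK.
  have b2 : adj (g (f w - s)) w.
    have := adj_shift (f w - s - h) hs.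
    by rewrite (addrAC h s) (addrC h) !subrK fK.
  (* The other midpoint [g (h - s)] would give [f w = h], against [wh]. *)
  have [] := common_neighbor ij ns nNs line_s l1 line_Ns l2 b1 b2.
    by move/(can_inj gK) => <-; rewrite subrK.
  by move/(can_inj gK)/addIr.
have w2 : f w = h - s - s.
  have b1 : adj (g h) (g (f w + s)).
    by have := @adj_shift _ (f w) s (eq_ind_r (adj _) a2 (fK w)); rewrite subrK.
  have b2 : adj (g (f w + s)) w.
    have := adj_shift (f w + s - h) hNs.
    by rewrite (addrAC h (- s)) (addrC h) subrK addrK fK.
  have [] := common_neighbor ij ns nNs line_s l1 line_Ns l2 b1 b2.
    by move/(can_inj gK)/addIr.
  by move/(can_inj gK) => <-; rewrite addrK.
have s4 : s *+ 4 = 0.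
  apply: (addrI h); rewrite addr0; apply: (addIr (- s)); apply: (addIr (- s)).
  by rewrite -w2 w1 !mulrS mulr0n addr0 !addrA !addrK.
(* Oddness of [p] enters here: 4 is coprime to [p ^ n], which also kills [s]. *)
have s0 : s = 0.
  have := mulrn_gcdn s4 (mulrn_card_H s).
  have /eqP -> : coprime 4 (p ^ n).
    by rewrite coprimeXr // (@coprimeXl 2 2) // coprime2n.
  by rewrite mulr1n.
by case: ns; rewrite s0 addr0.
Qed.

(** By induction: a step in direction [i] is reversed by [- s] at the point reached, again in
    direction [i], so [on_line_opp] there gives the next step [s] the same direction. *)
Let on_line_mulrn i h s k : adj (g h) (g (h + s)) ->
  on_line i (g h) (g (h + s)) -> on_line i (g h) (g (h + s *+ k)).
Proof.
move=> hs line_s.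
have adj_k m : adj (g (h + s *+ m)) (g (h + s *+ m + s)).
  by have := adj_shift (s *+ m) hs; rewrite addrAC.
suff step m : on_line i (g (h + s *+ m)) (g (h + s *+ m + s)).
  elim: k => [|k IHk] j ji; first by rewrite addr0.
  by rewrite mulrSr addrA -step // IHk.
elim: m => [|m IHm]; first by rewrite addr0.
have := @on_line_opp i (h + s *+ m + s) (- s).
rewrite addrK opprK mulrSr !addrA; apply=> [|j /IHm //].
exact: adj_sym.
Qed.

(** Pigeonhole: the multiples of [s] from 0 to [p] lead from [u] to points of one line of [p]
    vertices, so two of them coincide and some [s *+ k] with [0 < k <= p] vanishes. *)
Let mulrn_adj u v : adj u v -> (f v - f u) *+ p = 0.
Proof.
move=> uv; have [i line_uv _] := uv; set s := f v - f u.
have fs : f u + s = f v by rewrite addrC subrK.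
pose F (k : 'I_p.+1) := g (f u + s *+ k) i.
have line_k k : on_line i u (g (f u + s *+ k)).
  by rewrite -{1}[u]fK; apply: on_line_mulrn; rewrite fs !fK.
have /injectivePn[k1 [k2 k12 Fk]] : ~~ injectiveb F.
  apply/injectiveP => /leq_card; rewrite card_ord cardT.
  by rewrite ltnn.
have /eqP : s *+ k1 = s *+ k2.
  apply: (addrI (f u)); apply: (can_inj gK); apply/ffunP => j.
  by have [->//|ji] := eqVneq j i; rewrite -!line_k.
wlog lt12 : k1 k2 k12 {Fk} / (k1 < k2)%N => [IH|].
  case: (ltngtP k1 k2) => [|lt|/val_inj k12E]; first exact: IH.
    by rewrite eq_sym; apply: IH => //; rewrite eq_sym.
  by rewrite k12E eqxx in k12.
rewrite eq_sym -subr_eq0 -mulrnBr 1?ltnW // => /eqP sk.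
apply: (mulrn_prime_of_le p_prime (mulrn_card_H s) _ sk).
by rewrite subn_gt0 lt12 (leq_trans (leq_subr _ _)) // -ltnS.
Qed.

(** By [mulrn_adj], [f u *+ p] does not change along edges, so it is constant on the connected
    product; at [g 0] it is 0. *)
Lemma mulrn_cayley_product (h : H) : h *+ p = 0.
Proof.
have Fadj u v : adj u v -> f u *+ p = f v *+ p.
  by move/mulrn_adj/eqP; rewrite mulrnBl subr_eq0 => /eqP.
pose upd (u : V) (i : 'I_n) x : V := [ffun j => if j == i then x else u j].
have Fupd u i x y : f (upd u i x) *+ p = f (upd u i y) *+ p.
  apply: (connected_const (F := fun z => f (upd u i z) *+ p) (E_conn i)).
  move=> {}x {}y xy; apply: Fadj.
  by exists i => [j ji|]; rewrite !ffunE ?eqxx ?xy // (negPf ji).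
suff Fconst u v : f u *+ p = f v *+ p.
  by rewrite -[h]gK (Fconst _ (g 0)) gK mul0rn.
(* Hybrids lead from [u] to [v] one coordinate at a time, each change staying inside a connected
   factor. *)
pose hyb k : V := [ffun j : 'I_n => if (j < k)%N then v j else u j].
have hyb_step k : (k < n)%N -> f (hyb k) *+ p = f (hyb k.+1) *+ p.
  move=> kn; pose i := Ordinal kn.
  have -> : hyb k = upd (hyb k) i (u i).
    by apply/ffunP => j; rewrite !ffunE; case: eqVneq => // ->; rewrite ltnn.
  rewrite (Fupd _ _ _ (v i)); congr (f _ *+ p); apply/ffunP => j; rewrite !ffunE.
  have [->|ji] := eqVneq j i; first by rewrite ltnSn.
  by rewrite ltnS [(j <= k)%N]leq_eqVlt (negPf (ji : (j : nat) != k)).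
have hyb_const k : (k <= n)%N -> f (hyb 0%N) *+ p = f (hyb k) *+ p.
  elim: k => // k IHk kn; rewrite IHk 1?ltnW //; exact: hyb_step.
have -> : u = hyb 0%N by apply/ffunP => j; rewrite ffunE.
rewrite (hyb_const n) //; congr (f _ *+ p).
by apply/ffunP => j; rewrite ffunE ltn_ord.
Qed.

End ProductCayley.

(** * Size of a quotient of the integer lattice killed by [p] *)

Lemma to_modD n (M : 'M[int]_n) : {morph @to_mod n M : u v / u + v}.
Proof. by move=> u v; rewrite /to_mod raddfD. Qed.

Lemma to_modK n (M : 'M[int]_n) (x : int_mod M) : to_mod M (repr x) = x.
Proof. exact: reprK. Qed.

Lemma to_modMn n (M : 'M[int]_n) (u : 'cV[int]_n) k :
  to_mod M (u *+ k) = to_mod M u *+ k.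
Proof. by rewrite /to_mod raddfMn. Qed.


(** Since [p] kills the quotient, a class is determined by the residues modulo [p] of the entries of
    a representative, and there are [p ^ n] residue vectors. *)
Lemma leq_card_exponent_int_mod n (M : 'M[int]_n) (T : finType) (p : nat)
    (f : int_mod M -> T) : (0 < p)%N -> (forall x : int_mod M, x *+ p = 0) ->
  bijective f -> (#|T| <= p ^ n)%N.
Proof.
case: p => // p _ Mp [g fK gK].
pose res (x : int_mod M) : {ffun 'I_n -> 'I_p.+1} :=
  [ffun i => inord `|(repr x i 0%R %% p.+1%:Z)%Z|%N].
pose lift (c : {ffun 'I_n -> 'I_p.+1}) := to_mod M (\col_i (c i)%:Z).
have resK : cancel res lift.
  move=> x; rewrite -[RHS]to_modK.
  (* Entrywise Euclidean division by [p]; the multiple of [p] then vanishes in the quotient. *)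
  have -> : repr x =
      \col_i (res x i)%:Z + (\col_i (repr x i 0%R %/ p.+1%:Z)%Z) *+ p.+1.
    apply/colP => i; rewrite !(mxE, mulmxnE) ffunE /= inordK; last first.
      rewrite -ltz_nat gez0_abs ?modz_ge0 //; exact: ltz_pmod.
    rewrite gez0_abs ?modz_ge0 // {1}(divz_eq (repr x i 0) p.+1%:Z).
    by rewrite addrC pmulrn -mulrzr intz.
  by rewrite to_modD to_modMn Mp addr0.
rewrite -[X in (_ ^ X)%N]card_ord -[X in (X ^ _)%N]card_ord -card_ffun.
apply: (@leq_card _ _ (res \o g)); apply: inj_comp; last exact: can_inj gK.
exact: can_inj resK.
Qed.

Lemma intr_Zp_eq0 p (z : int) : (1 < p)%N -> (z%:~R : 'Z_p) = 0 ->
  exists q, z = p%:Z * q.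
Proof.
move=> p1 z0; suff /dvdzP[q ->] : (p%:Z %| z)%Z by exists q; rewrite mulrC.
have nat0 k : (k%:R : 'Z_p) = 0 -> (p %| k)%N.
  by move/(congr1 val); rewrite /= val_Zp_nat // => /eqP.
rewrite dvdzE /=; apply: nat0; case: z z0 => k //=.
by rewrite NegzE mulrNz => /eqP; rewrite oppr_eq0 => /eqP.
Qed.

(** * Coordinates modulo [p] on the quotient by the diagonal matrix *)

Section DiagonalCirculant.

Variables (p n : nat) (A : 'I_n -> {set 'Z_p}).
Hypothesis p_gt1 : (1 < p)%N.

Local Notation M := (diag_mx (const_mx p%:Z) : 'M[int]_n).

Let residues (x : int_mod M) : {ffun 'I_n -> 'Z_p} :=
  [ffun i => (repr x i 0)%:~R].

Let of_residues (v : {ffun 'I_n -> 'Z_p}) : int_mod M :=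
  to_mod M (\col_i (v i : nat)%:Z).

Let intr_ord (a : 'Z_p) : (a : nat)%:~R = a.
Proof. exact: natr_Zp. Qed.

(** Two representatives of a class differ by some [M *m z], whose entries are multiples of [p], so
    the choice made by [repr] is immaterial. *)
Let residues_to_mod u i : residues (to_mod M u) i = (u i 0)%:~R.
Proof.
have /to_mod_eq[z uz] := to_modK (to_mod M u).
rewrite ffunE -[repr _](subrK u) uz mxE mul_diag_mx !mxE rmorphD rmorphM /=.
by rewrite -pmulrn pchar_Zp // mul0r add0r.
Qed.

Let residuesD x y i : residues (x + y) i = residues x i + residues y i.
Proof.
rewrite -[in LHS](to_modK x) -[in LHS](to_modK y) -to_modD residues_to_mod.
by rewrite !ffunE mxE rmorphD.
Qed.

Let of_residuesK : cancel of_residues residues.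
Proof.
by move=> v; apply/ffunP => i; rewrite residues_to_mod mxE intr_ord.
Qed.

Let residuesK : cancel residues of_residues.
Proof.
move=> x; rewrite -[RHS]to_modK; apply/to_mod_eq.
have q i : exists q, (residues x i : nat)%:Z - repr x i 0 = p%:Z * q.
  apply: intr_Zp_eq0 => //; rewrite rmorphB /= ffunE.
  by rewrite intr_ord subrr.
(* The entrywise quotients by [p] are collected into one vector, the witness of lattice
   membership. *)
have [h hE] := choice q; exists (\col_i h i).
by apply/colP => i; rewrite mul_diag_mx !mxE.
Qed.

(** In [residues] coordinates, adding [a] times the [i]th unit vector shifts coordinate [i] by [a]
    and fixes the others. *)
Lemma axis_mcirculant_iso :
  digraph_iso (mcirculant (axis_set A M))
    (cartesian_product (fun i : 'I_n => circulant (A i))).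
Proof.
exists residues; first by exists of_residues.
move=> u v; split.
  case=> _ [i [a [Aa ->]]] ->.
  exists i; split=> [|j ji].
    apply/existsP; exists a; rewrite Aa residuesD residues_to_mod !mxE !eqxx mulr1.
    by rewrite intr_ord eqxx.
  by rewrite residuesD residues_to_mod !mxE (negPf ji) mulr0 addr0.
case=> i [/existsP[a /andP[Aa /eqP via]] vj].
exists (to_mod M ((a : nat)%:Z *: delta_mx i 0)); first by exists i, a.
apply: (can_inj residuesK); apply/ffunP => j.
rewrite residuesD residues_to_mod !mxE eqxx andbT.
have [->|ji] := eqVneq j i; last by rewrite mulr0 addr0 vj.
by rewrite mulr1 via intr_ord.
Qed.

End DiagonalCirculant.

(** * Transport of representations and the value of the dimension *)

Lemma digraph_iso_sym (T1 T2 : Type) (E1 : T1 -> T1 -> Prop)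
    (E2 : T2 -> T2 -> Prop) : digraph_iso E1 E2 -> digraph_iso E2 E1.
Proof.
move=> [f [g fK gK] fE]; exists g; first by exists f.
by move=> u v; rewrite fE !gK.
Qed.

Lemma digraph_iso_trans (T1 T2 T3 : Type) (E1 : T1 -> T1 -> Prop)
    (E2 : T2 -> T2 -> Prop) (E3 : T3 -> T3 -> Prop) :
  digraph_iso E1 E2 -> digraph_iso E2 E3 -> digraph_iso E1 E3.
Proof.
move=> [f f_bij fE] [g g_bij gE]; exists (g \o f); first exact: bij_comp.
by move=> u v; rewrite fE gE.
Qed.

Theorem theorem3p7 (p n : nat) (p_prime : prime p) (p_gt2 : (2 < p)%N)
    (n_gt0 : (0 < n)%N) (A : 'I_n -> {set 'Z_p})
    (A_nz : forall i : 'I_n, 0 \notin A i)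
    (A_conn : forall i : 'I_n, connected (circulant (A i))) :
  let M : 'M[int]_n := diag_mx (const_mx p%:Z) in
  let G := mcirculant (axis_set A M) in
  digraph_iso G (cartesian_product (fun i : 'I_n => circulant (A i)))
  /\ has_dimension G n.
Proof.
move=> M G; have p_gt1 := prime_gt1 p_prime; have p_gt0 := prime_gt0 p_prime.
have iso := axis_mcirculant_iso A p_gt1; split=> //; split.
  exists M, (axis_set A M); split; last by exists id; first exists id.
  rewrite det_diag; apply/prodf_neq0 => i _; rewrite mxE.
  by rewrite eqz_nat -lt0n.
(* Any representation of [G] is carried over to the cartesian product, whose vertices it identifies
   with the group [int_mod M']. *)
move=> m [M' [A' [_ /(digraph_iso_trans (digraph_iso_sym iso))[f [g fK gK] fE]]]].
have cardZ : #|'Z_p| = p by rewrite card_ord Zp_cast.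
have irr i x : ~~ circulant (A i) x x.
  apply/existsP => -[a /andP[Aa /eqP]].
  by rewrite -[X in X = _]addr0 => /addrI a0; case/negP: (A_nz i); rewrite a0.
have p_odd : odd p by case: (even_prime p_prime) p_gt2 => // ->.
have H'p (x : int_mod M') : x *+ p = 0.
  exact: (mulrn_cayley_product p_prime p_odd cardZ irr A_conn fK gK fE).
have : (#|{ffun 'I_n -> 'Z_p}| <= p ^ m)%N.
  by apply: (leq_card_exponent_int_mod p_gt0 H'p (f := g)); exists f.
by rewrite card_ffun cardZ card_ord leq_exp2l.
Qed.
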